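(* Let $V,H$ be separable complex Hilbert spaces such that $V$ is continuously and densely imbedded in $H$. Let $a:V\times V\to\mathbb C$ be a sesquilinear mapping. Let $\alpha\in[0,1)$ and let $H_\alpha$ be an interpolation space between $V$ and $H$ for which there is a constant $M_\alpha$ with $$\|f\|_{H_\alpha}\leq M_\alpha\|f\|_V^\alpha\|f\|_H^{1-\alpha},\qquad f\in V.$$ Let $a_1:V\times H_\alpha\to\mathbb C$ and $a_2:H_\alpha\times V\to\mathbb C$ be continuous sesquilinear mappings. Then $a$ is $H$-elliptic if and only if $a+a_1+a_2:V\times V\to\mathbb C$ is $H$-elliptic.
   Context: A sesquilinear form $c:V\times V\to\mathbb C$ is called $H$-elliptic if there exist $\delta>0$ and $\omega\in\mathbb R$ such that $\mathrm{Re}\,c(f,f)\geq \delta\|f\|_V^2-\omega\|f\|_H^2$ for all $f\in V$. An interpolation space $H_\alpha$ between $V$ and $H$ satisfies in particular $V\hookrightarrow H_\alpha\hookrightarrow H$ (continuous imbeddings). A sesquilinear mapping $c:X\times Y\to\mathbb C$ is continuous if $|c(f,g)|\le M\|f\|_X\|g\|_Y$ for some constant $M$ and all $f\in X$, $g\in Y$. The sum $a+a_1+a_2$ is understood on $V\times V$, via the restrictions of $a_1,a_2$ to $V\times V$. *)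

(* Defs.v *)
From HB Require Import structures.
From mathcomp Require Import all_boot all_order all_algebra.
From mathcomp Require Import sesquilinear complex.
From mathcomp Require Import all_classical all_reals all_analysis.

Set Implicit Arguments.
Unset Strict Implicit.
Unset Printing Implicit Defensive.

Import Order.TTheory GRing.Theory Num.Theory.
Import numFieldNormedType.Exports.

Local Open Scope classical_set_scope.
Local Open Scope ring_scope.

(* Linear in the first argument, conjugate-linear in the second. *)
Notation "{ 'sesquilinear' U * V }" :=
  {bilinear U -> V -> _ | *%R & (Num.conj \; *%R)}
  (U at level 39, V at level 40, format "{ 'sesquilinear'  U  *  V }")
  : type_scope.

(* The norm of a normed space over R[i] takes its values in R[i]; every norm is
   a nonnegative real element there, so taking the real part loses nothing. *)
Definition rnorm (R : realType) (V : normedZmodType R[i]) (x : V) : R :=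
  complex.Re `|x|.

HB.mixin Record isHilbert (R : realType) V of CompleteNormedModule R[i] V := {
  inner : {dot V for (@Num.conj R[i])};
  inner_norm : forall x : V, `|x| ^+ 2 = inner x x
}.

#[short(type="hilbertType")]
HB.structure Definition Hilbert (R : realType) :=
  {V of CompleteNormedModule R[i] V & isHilbert R V}.

Definition separable_space (T : topologicalType) : Prop :=
  exists2 D : set T, countable D & dense D.

Definition continuous_embedding (R : realType) (V W : normedModType R[i])
    (j : {linear V -> W}) : Prop :=
  injective j /\ continuous j.

(* [X] is an interpolation space for the Banach couple [V] -> [H]: for [V]
   embedded in [H], the intersection of the couple is [V] and its sum is [H].
   Since [j2] is injective, the operator [TX] below is the restriction of [TH]
   to [X]. *)
Definition interpolation_space (R : realType)
    (V X H : completeNormedModType R[i]) (j : {linear V -> H})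
    (j1 : {linear V -> X}) (j2 : {linear X -> H}) : Prop :=
  [/\ continuous_embedding j1,
      continuous_embedding j2,
      forall f : V, j2 (j1 f) = j f &
      forall (TV : {linear V -> V}) (TH : {linear H -> H}),
        continuous TV -> continuous TH -> (forall f, TH (j f) = j (TV f)) ->
        exists2 TX : {linear X -> X},
          continuous TX & forall x, TH (j2 x) = j2 (TX x)].

Definition continuous_form (R : realType) (X Y : normedModType R[i])
    (c : {sesquilinear X * Y}) : Prop :=
  exists M : R, forall f g, rnorm (c f g) <= M * rnorm f * rnorm g.

Definition elliptic (R : realType) (V H : normedModType R[i])
    (j : {linear V -> H}) (c : {sesquilinear V * V}) : Prop :=
  exists delta omega : R, 0 < delta /\
    forall f : V,
      complex.Re (c f f) >= delta * rnorm f ^+ 2 - omega * rnorm (j f) ^+ 2.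

Section FormSum.
Variables (R : realType) (V X : normedModType R[i]) (j : {linear V -> X}).
Variables (a : {sesquilinear V * V}) (a1 : {sesquilinear V * X})
  (a2 : {sesquilinear X * V}).

(* [a + a1 + a2], with [a1] and [a2] restricted to [V * V] along [j] *)
Definition form_sum (f g : V) : R[i] := a f g + a1 f (j g) + a2 (j f) g.

Fact form_sum_sesquilinear :
  bilinear_for (GRing.Scale.Law.clone _ _ *%R _)
    (GRing.Scale.Law.clone _ _ (Num.conj \; *%R) _) form_sum.
Proof.
split=> [g|f] k x y; rewrite /form_sum /= (linearP j k x y) /=.
- by rewrite !linearPl !mulrDr [RHS]addrACA; congr (_ + _); exact: addrACA.
- by rewrite !linearPr /= !mulrDr [RHS]addrACA; congr (_ + _); exact: addrACA.
Qed.

HB.instance Definition _ := bilinear_isBilinear.Build R[i] V V R[i]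
  *%R (Num.conj \; *%R) form_sum form_sum_sesquilinear.

End FormSum.

(* Main.v *)
(* The perturbation [a1 f (j1 f) + a2 (j1 f) f] is bounded by a multiple of
   [|f|_V ^ (1 + alpha) * |j f|_H ^ (1 - alpha)].  Since [alpha < 1], this is at most
   [eps * |f|_V ^ 2 + C * |j f|_H ^ 2] with [eps] arbitrarily small, so it is absorbed by half
   of the ellipticity constant.  The bound on the difference of the two forms
   is symmetric in them, which gives both implications. *)

Require Import Defs.
From HB Require Import structures.
From mathcomp Require Import all_boot all_order all_algebra.
From mathcomp Require Import sesquilinear complex.
From mathcomp Require Import all_classical all_reals all_analysis.
From mathcomp Require Import ring lra.
Import Order.TTheory GRing.Theory Num.Theory.
Import numFieldNormedType.Exports.
Local Open Scope classical_set_scope.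
Local Open Scope ring_scope.

Lemma rnorm_ge0 (R : realType) (V : normedZmodType R[i]) (x : V) :
  0 <= rnorm x.
Proof. by have := normr_ge0 x; rewrite lecE => /andP[]. Qed.

Lemma normr_Re_le_rnorm (R : realType) (z : R[i]) :
  `|complex.Re z| <= rnorm z.
Proof. by have := normc_ge_Re z; rewrite lecE => /andP[]. Qed.

(** An elementary form of Young's inequality, by comparing [h] with [t * v]. When [h / v] is small,
    so is [(h / v) ^ (1 - alpha)], because [1 - alpha > 0], and the [v ^+ 2] term suffices;
    otherwise [v] is at most a fixed multiple of [h], and the [h ^+ 2] term suffices. *)
Lemma powR_interpolation_absorb (R : realType) (alpha K eps : R) :
  0 <= alpha -> alpha < 1 -> 0 <= K -> 0 < eps ->
  exists C : R, forall v h : R, 0 <= v -> 0 <= h ->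
    K * (v * (v `^ alpha * h `^ (1 - alpha))) <= eps * v ^+ 2 + C * h ^+ 2.
Proof.
move=> alpha_ge0 alpha_lt1 K_ge0 eps_gt0.
have beta_gt0 : 0 < 1 - alpha by rewrite subr_gt0.
have K1_gt0 : 0 < K + 1 by lra.
(* The threshold solves [t ^ (1 - alpha) = eps / (K + 1)]. Taking [K + 1] rather than [K] keeps [t]
   meaningful for [K = 0] and costs only a factor [K / (K + 1) <= 1]. *)
pose t := (eps / (K + 1)) `^ (1 - alpha)^-1.
have t_gt0 : 0 < t by rewrite powR_gt0 // divr_gt0.
have tE : t `^ (1 - alpha) = eps / (K + 1).
  by rewrite /t -powRrM mulVf ?gt_eqF // powRr1 // ltW // divr_gt0.
(* This includes [x = 0], since the exponents add up to [1], which is nonzero. *)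
have powD (x : R) : 0 <= x -> x `^ alpha * x `^ (1 - alpha) = x.
  by move=> x0; rewrite -powRD ?subrKC ?powRr1 // oner_eq0.
(* The constant comes from the case [t * v < h], by replacing both occurrences of [v] with
   [t^-1 * h]. *)
exists (K * t^-1 * t^-1 `^ alpha) => v h v_ge0 h_ge0.
have [h_le|h_gt] := leP h (t * v).
- apply: (@le_trans _ _ (eps * v ^+ 2)); last first.
    by rewrite lerDl !mulr_ge0 ?powR_ge0 ?invr_ge0 ?(ltW t_gt0) ?sqr_ge0.
  have pow_le : v `^ alpha * h `^ (1 - alpha) <= eps / (K + 1) * v.
    rewrite -[X in _ <= _ * X](powD v v_ge0) mulrCA -tE.
    rewrite -powRM ?(ltW t_gt0) // ler_wpM2l ?powR_ge0 //.
    by rewrite ge0_ler_powR ?(ltW beta_gt0) ?nnegrE ?mulr_ge0 ?(ltW t_gt0).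
  apply: (@le_trans _ _ (K * (v * (eps / (K + 1) * v)))).
    by rewrite ler_wpM2l // ler_wpM2l.
  have -> : K * (v * (eps / (K + 1) * v)) = K / (K + 1) * (eps * v ^+ 2).
    by ring.
  rewrite ler_piMl ?mulr_ge0 ?sqr_ge0 ?(ltW eps_gt0) //.
  by rewrite ler_pdivrMr // mul1r lerDl.
- have v_le : v <= t^-1 * h by rewrite ler_pdivlMl // ltW.
  have ti_ge0 : 0 <= t^-1 by rewrite invr_ge0 ltW.
  apply: (@le_trans _ _ (K * t^-1 * t^-1 `^ alpha * h ^+ 2)); last first.
    by rewrite lerDr mulr_ge0 ?sqr_ge0 // ltW.
  have pow_le : v `^ alpha * h `^ (1 - alpha) <= t^-1 `^ alpha * h.
    rewrite -[X in _ <= _ * X](powD h h_ge0) mulrA -powRM //.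
    rewrite ler_wpM2r ?powR_ge0 //.
    by rewrite ge0_ler_powR ?nnegrE ?mulr_ge0.
  have -> : K * t^-1 * t^-1 `^ alpha * h ^+ 2 =
            K * (t^-1 * h * (t^-1 `^ alpha * h)) by ring.
  by rewrite ler_wpM2l // ler_pM ?mulr_ge0 ?powR_ge0.
Qed.

Lemma elliptic_perturb (R : realType) (V H : normedModType R[i])
    (j : {linear V -> H}) (a b : {sesquilinear V * V}) (alpha K : R) :
  0 <= alpha -> alpha < 1 -> 0 <= K ->
  (forall f, `|complex.Re (a f f) - complex.Re (b f f)| <=
    K * (rnorm f * (rnorm f `^ alpha * rnorm (j f) `^ (1 - alpha)))) ->
  elliptic j a -> elliptic j b.
Proof.
move=> alpha_ge0 alpha_lt1 K_ge0 ab_le [delta [omega [delta_gt0 ell_a]]].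
have d2_gt0 : 0 < delta / 2 by rewrite divr_gt0.
have [C absorb] := powR_interpolation_absorb _ _ _ _
  alpha_ge0 alpha_lt1 K_ge0 d2_gt0.
(* Absorption with [eps = delta / 2] leaves half of [delta]; its [C] is added to [omega]. *)
exists (delta / 2), (omega + C); split=> // f.
have := absorb _ _ (rnorm_ge0 _ _ f) (rnorm_ge0 _ _ (j f)).
have := le_trans (ler_norm _) (ab_le f).
have := ell_a f.
set x := rnorm f ^+ 2; set y := rnorm (j f) ^+ 2.
by lra.
Qed.

Theorem lemma2p1 (R : realType) (V H : hilbertType R)
    (sepV : separable_space V) (sepH : separable_space H)
    (j : {linear V -> H}) (embj : continuous_embedding j)
    (densej : dense (range j))
    (a : {sesquilinear V * V})
    (alpha : R) (alpha_ge0 : 0 <= alpha) (alpha_lt1 : alpha < 1)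
    (Ha : completeNormedModType R[i])
    (j1 : {linear V -> Ha}) (j2 : {linear Ha -> H})
    (interpHa : interpolation_space j j1 j2)
    (Ma : R)
    (interp_ineq : forall f : V,
      rnorm (j1 f) <= Ma * (rnorm f `^ alpha) * (rnorm (j f) `^ (1 - alpha)))
    (a1 : {sesquilinear V * Ha}) (a2 : {sesquilinear Ha * V})
    (cont_a1 : continuous_form a1) (cont_a2 : continuous_form a2) :
  elliptic j a <-> elliptic j (form_sum j1 a a1 a2).
Proof.
have [M1 a1_le] := cont_a1; have [M2 a2_le] := cont_a2.
(* Absolute values are taken because no sign is assumed for [M1], [M2] and [Ma]. *)
pose K := (`|M1| + `|M2|) * `|Ma|.
have K_ge0 : 0 <= K by rewrite mulr_ge0 ?addr_ge0.
have diff_le f :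
    `|complex.Re (form_sum j1 a a1 a2 f f) - complex.Re (a f f)| <=
    K * (rnorm f * (rnorm f `^ alpha * rnorm (j f) `^ (1 - alpha))).
  have -> : complex.Re (form_sum j1 a a1 a2 f f) - complex.Re (a f f) =
      complex.Re (a1 f (j1 f)) + complex.Re (a2 (j1 f) f).
    by rewrite /form_sum !raddfD /=; ring.
  have v_ge0 := rnorm_ge0 _ _ f; have x_ge0 := rnorm_ge0 _ _ (j1 f).
  (* Continuity of the two forms gives this bound; the interpolation inequality then replaces
     [rnorm (j1 f)]. *)
  apply: (@le_trans _ _ ((`|M1| + `|M2|) * (rnorm f * rnorm (j1 f)))).
    apply: le_trans (ler_normD _ _) _; rewrite mulrDl lerD //.
      apply: le_trans (normr_Re_le_rnorm _ _) (le_trans (a1_le _ _) _).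
      by rewrite -mulrA ler_wpM2r ?mulr_ge0 ?ler_norm.
    apply: le_trans (normr_Re_le_rnorm _ _) (le_trans (a2_le _ _) _).
    by rewrite -mulrA [rnorm (j1 f) * _]mulrC ler_wpM2r ?mulr_ge0 ?ler_norm.
  rewrite /K -mulrA ler_wpM2l ?addr_ge0 // mulrCA ler_wpM2l //.
  apply: le_trans (interp_ineq f) _.
  by rewrite -mulrA ler_wpM2r ?mulr_ge0 ?powR_ge0 ?ler_norm.
split; apply: elliptic_perturb alpha_ge0 alpha_lt1 K_ge0 _.
- by move=> f; rewrite distrC; exact: diff_le.
- exact: diff_le.
Qed.
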